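(* Let $m\ge2$, let $N\subset\mathbf R^m$ be a nonempty closed subset, and let $k$ be an integer with $1\le k\le m$. Suppose that $p\in\Sigma_{k+1}(N)$ and $\dim\operatorname{conv}(\pi_N(p))=k$. Then there is an $(m-k)$-dimensional DC submanifold $S$ of $\mathbf R^m$ such that $$p\in S\subset\Sigma(N)\setminus\bigcup_{j=2}^k\Sigma_j(N).$$
   Context: $\mathbf R^m$ carries the standard Euclidean metric. $d_N:\mathbf R^m\setminus N\to(0,\infty)$ is $d_N(p)=\inf_{q\in N}|q-p|$; $\Sigma(N)$ is the set of $p\in\mathbf R^m\setminus N$ at which $d_N$ is not differentiable; $\pi_N(p):=\{q\in N\mid d_N(p)=|q-p|\}$. It is known that $\Sigma(N)=\{p\in\mathbf R^m\setminus N\mid\#\pi_N(p)\ge2\}$. For an integer $j\ge2$, $\Sigma_j(N):=\{p\in\Sigma(N)\mid\#\pi_N(p)=j\}$. $\operatorname{conv}$ denotes the convex hull, and its dimension is that of its affine hull; an empty union is empty. A continuous function $u:\Omega\to\mathbf R$ on an open set $\Omega\subset\mathbf R^n$ is (locally) delta-convex (DC) if on every open convex set $\Omega'$ with compact closure in $\Omega$ it is the difference of two convex functions; a vector-valued map is DC if each component is; for maps defined on an open subset of an affine subspace, identify the affine subspace with a Euclidean space by an isometry. For $1\le d\le m-1$, a subset $S\subset\mathbf R^m$ is a $d$-dimensional DC submanifold of $\mathbf R^m$ if for every $p\in S$ there are an open neighborhood $U$ of $p$ in $\mathbf R^m$ and a $d$-dimensional affine subspace $P\subset\mathbf R^m$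 such that, with $\pi$ the orthogonal projection onto $P$, the set $\pi(S\cap U)$ is open in $P$, $\pi|_{S\cap U}$ is bi-Lipschitz, and $(\pi|_{S\cap U})^{-1}:\pi(S\cap U)\to S\cap U$ is a DC map. A $0$-dimensional DC submanifold means a point. *)

(* Defs.v *)
From HB Require Import structures.
From mathcomp Require Import all_boot all_order all_algebra.
From mathcomp Require Import all_classical all_reals all_analysis.
Set Implicit Arguments.
Unset Strict Implicit.
Unset Printing Implicit Defensive.
Import Order.TTheory GRing.Theory Num.Theory.
Import numFieldNormedType.Exports.
Local Open Scope classical_set_scope.
Local Open Scope ring_scope.

(* The library norm on 'rV[R]_n is the sup norm. All metric notions below use
   the Euclidean norm enorm; the library is used only for topology (open,
   closed, compact, continuous) and differentiability, which are the same for
   both norms. *)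
Definition dotv (R : realType) (n : nat) (u v : 'rV[R]_n) : R :=
  \sum_(i < n) u 0 i * v 0 i.

Definition enorm (R : realType) (n : nat) (u : 'rV[R]_n) : R :=
  Num.sqrt (dotv u u).

(* Total on R^n; only its values on the open set ~` N matter in Sigma, since
   differentiability at a point is local. *)
Definition dist_to (R : realType) (n : nat) (N : set 'rV[R]_n)
    (p : 'rV[R]_n) : R :=
  inf [set enorm (q - p) | q in N].

Definition Sigma (R : realType) (n : nat) (N : set 'rV[R]_n) : set 'rV[R]_n :=
  [set p | ~ N p /\ ~ differentiable (dist_to N) p].

Definition nearest (R : realType) (n : nat) (N : set 'rV[R]_n)
    (p : 'rV[R]_n) : set 'rV[R]_n :=
  [set q | N q /\ dist_to N p = enorm (q - p)].

Definition Sigma_card (R : realType) (n : nat) (j : nat) (N : set 'rV[R]_n) :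
    set 'rV[R]_n :=
  [set p | Sigma N p /\ (nearest N p #= `I_j)%card].

(* In particular P is nonempty. *)
Definition affine_subspace (R : realType) (n : nat) (d : nat)
    (P : set 'rV[R]_n) : Prop :=
  exists (a : 'rV[R]_n) (V : {vspace 'rV[R]_n}),
    (\dim V)%VS = d /\ P = [set a + v | v in [set` V]].

Definition affine_hull (R : realType) (n : nat) (A : set 'rV[R]_n) :
    set 'rV[R]_n :=
  smallest [set P | exists d, affine_subspace d P] A.

Definition convex_hull (R : realType) (n : nat) (A : set 'rV[R]_n) :
    set 'rV[R]_n :=
  smallest [set C : set 'rV[R]_n | convex_set C] A.

(* dim A = d, for a nonempty set A *)
Definition has_affine_dim (R : realType) (n : nat) (A : set 'rV[R]_n)
    (d : nat) : Prop :=
  affine_subspace d (affine_hull A).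

Definition dc_on (R : realType) (n : nat) (W : set 'rV[R]_n)
    (u : 'rV[R]_n -> R) : Prop :=
  [/\ open W, {within W, continuous u} &
    forall W' : set 'rV[R]_n,
      open W' -> convex_set W' -> compact (closure W') -> closure W' `<=` W ->
      exists f g : 'rV[R]_n -> R,
        [/\ convex_function W' f, convex_function W' g &
          forall x, W' x -> u x = f x - g x]].

Definition isometry_onto (R : realType) (n d : nat) (P : set 'rV[R]_n)
    (phi : 'rV[R]_d -> 'rV[R]_n) : Prop :=
  (forall x y, enorm (phi x - phi y) = enorm (x - y)) /\ range phi = P.

(* The choice of phi is immaterial: two choices differ by an isometry of R^d,
   and these are affine, so preserve dc_on. *)
Definition dc_map_on_affine (R : realType) (n l d : nat) (P : set 'rV[R]_n)
    (W : set 'rV[R]_n) (g : 'rV[R]_n -> 'rV[R]_l) : Prop :=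
  exists phi : 'rV[R]_d -> 'rV[R]_n,
    isometry_onto P phi /\
    forall j : 'I_l, dc_on (phi @^-1` W) (fun y => g (phi y) 0 j).
Arguments dc_map_on_affine {R n l} d P W g.

Definition orthogonal_projection (R : realType) (n : nat) (P : set 'rV[R]_n)
    (prj : 'rV[R]_n -> 'rV[R]_n) : Prop :=
  forall x, P (prj x) /\ forall y, P y -> dotv (x - prj x) (y - prj x) = 0.

Definition bilipschitz_on (R : realType) (n l : nat) (A : set 'rV[R]_n)
    (f : 'rV[R]_n -> 'rV[R]_l) : Prop :=
  exists2 L : R, 0 < L & forall x y, A x -> A y ->
    L^-1 * enorm (x - y) <= enorm (f x - f y) <= L * enorm (x - y).

(* g extends the inverse of the restriction of prj to S `&` U arbitrarily
   outside prj @` (S `&` U). *)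
Definition dc_chart (R : realType) (n d : nat) (S : set 'rV[R]_n)
    (U P : set 'rV[R]_n) (prj g : 'rV[R]_n -> 'rV[R]_n) : Prop :=
  let W := prj @` (S `&` U) in
  [/\ exists2 O : set 'rV[R]_n, open O & W = O `&` P,
      bilipschitz_on (S `&` U) prj,
      {in S `&` U, cancel prj g} &
      dc_map_on_affine d P W g].
Arguments dc_chart {R n} d S U P prj g.

Definition dc_submanifold (R : realType) (n d : nat) (S : set 'rV[R]_n) :
    Prop :=
  (d = 0%N /\ exists p, S = [set p]) \/
  ((1 <= d <= n.-1)%N /\
   forall p, S p ->
     exists U P : set 'rV[R]_n, exists prj g : 'rV[R]_n -> 'rV[R]_n,
       [/\ open U, U p, affine_subspace d P, orthogonal_projection P prj &
           dc_chart d S U P prj g]).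
Arguments dc_submanifold {R n} d S.

(* Main.v *)
Require Import Defs.
From HB Require Import structures.
From mathcomp Require Import all_boot all_order all_algebra.
From mathcomp Require Import all_classical all_reals all_analysis.
From mathcomp Require Import ring lra zify.
Set Implicit Arguments.
Unset Strict Implicit.
Unset Printing Implicit Defensive.
Import Order.TTheory GRing.Theory Num.Theory.
Import numFieldNormedType.Exports.
Local Open Scope classical_set_scope.
Local Open Scope ring_scope.

(* Let q_0, ..., q_k be the nearest points of p and N_i the part of N in a small
   ball of radius r about q_i. Near p the distance to N is the least of the
   distances to the N_i, so a point x with all dist(x, N_i) equal has a nearest
   point in each N_i, hence at least k + 1 nearest points. By Asplund's identity
   h_i(x) = (|x|^2 - dist(x, N_i)^2) / 2 is convex, and e_i = h_i - <., q_i> is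
   moreover r-Lipschitz. The equations h_0 = ... = h_k are thus a small Lipschitz
   perturbation of the independent linear equations <x, q_i - q_0> = const. In
   coordinates x = p + zU + wC adapted to the span of the q_i - q_0 they have, by
   contraction, a unique solution w(z). With g(z) = \sum_i e_i on this graph,
   convexity of the e_i bounds the defect of affinity of w by that of g; this
   makes g convex and shows that w is DC. *)

Section Euclid.
Context {R : realType} {n : nat}.
Implicit Types (u v w x y : 'rV[R]_n) (a : R).

Lemma dotvC u v : dotv u v = dotv v u.
Proof. by apply: eq_bigr => i _; rewrite mulrC. Qed.

Lemma dotvDl u v w : dotv (u + v) w = dotv u w + dotv v w.
Proof. by rewrite -big_split; apply: eq_bigr => i _; rewrite mxE mulrDl. Qed.

Lemma dotvZl a u v : dotv (a *: u) v = a * dotv u v.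
Proof. by rewrite mulr_sumr; apply: eq_bigr => i _; rewrite mxE mulrA. Qed.

Lemma dotvNl u v : dotv (- u) v = - dotv u v.
Proof. by rewrite -scaleN1r dotvZl mulN1r. Qed.

Lemma dotvBl u v w : dotv (u - v) w = dotv u w - dotv v w.
Proof. by rewrite dotvDl dotvNl. Qed.

Lemma dotvDr u v w : dotv w (u + v) = dotv w u + dotv w v.
Proof. by rewrite dotvC dotvDl !(dotvC w). Qed.

Lemma dotvZr a u v : dotv u (a *: v) = a * dotv u v.
Proof. by rewrite dotvC dotvZl dotvC. Qed.

Lemma dotvBr u v w : dotv w (u - v) = dotv w u - dotv w v.
Proof. by rewrite dotvC dotvBl !(dotvC w). Qed.

Lemma dotvE u v : dotv u v = (u *m v^T) 0 0.
Proof. by rewrite mxE; apply: eq_bigr => i _; rewrite mxE. Qed.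

Lemma dotvv_ge0 u : 0 <= dotv u u.
Proof. by apply: sumr_ge0 => i _; rewrite -expr2 sqr_ge0. Qed.

Lemma dotvv_eq0 u : dotv u u = 0 -> u = 0.
Proof.
move=> /eqP; rewrite psumr_eq0; last by move=> i _; rewrite -expr2 sqr_ge0.
move=> /allP u0; apply/rowP => i; rewrite mxE.
by have /eqP := u0 i (mem_index_enum _); rewrite -expr2 => /eqP; rewrite sqrf_eq0 => /eqP.
Qed.

Lemma enorm_ge0 u : 0 <= enorm u.
Proof. exact: sqrtr_ge0. Qed.

Lemma enorm_sqr u : enorm u ^+ 2 = dotv u u.
Proof. by rewrite sqr_sqrtr // dotvv_ge0. Qed.

Lemma enorm0 : enorm (0 : 'rV[R]_n) = 0.
Proof. by rewrite /enorm -(scale0r 0) dotvZl mul0r sqrtr0. Qed.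

Lemma enorm_eq0 u : enorm u = 0 -> u = 0.
Proof. by move=> u0; apply: dotvv_eq0; rewrite -enorm_sqr u0 expr0n. Qed.

Lemma enormN u : enorm (- u) = enorm u.
Proof. by rewrite /enorm dotvNl dotvC dotvNl opprK. Qed.

Lemma enormB u v : enorm (u - v) = enorm (v - u).
Proof. by rewrite -enormN opprB. Qed.

Lemma enormZ a u : enorm (a *: u) = `|a| * enorm u.
Proof.
rewrite /enorm dotvZl dotvZr mulrA -expr2 sqrtrM ?sqr_ge0 //.
by rewrite sqrtr_sqr.
Qed.

Lemma enorm_sqrB u v : enorm (u - v) ^+ 2 = enorm u ^+ 2 - 2 * dotv u v + enorm v ^+ 2.
Proof. by rewrite !enorm_sqr dotvBl !dotvBr (dotvC v u); ring. Qed.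

Lemma cauchy_schwarz u v : `|dotv u v| <= enorm u * enorm v.
Proof.
rewrite -(@ler_pXn2r _ 2) ?nnegrE ?normr_ge0 ?mulr_ge0 ?enorm_ge0 //.
rewrite exprMn !enorm_sqr real_normK ?num_real //.
have [v0|/eqP v0] := eqVneq (dotv v v) 0.
  by rewrite (dotvv_eq0 v0) -(scale0r 0) !dotvZr !mul0r expr0n /= mulr0.
have := dotvv_ge0 (dotv v v *: u - dotv u v *: v).
rewrite dotvBl !dotvBr !dotvZl !dotvZr (dotvC v u).
have vp : 0 < dotv v v by rewrite lt_def dotvv_ge0 andbT; apply/eqP.
rewrite (_ : _ - _ = dotv v v * (dotv u u * dotv v v - dotv u v ^+ 2)); last by ring.
by rewrite pmulr_rge0 // subr_ge0.
Qed.

Lemma dotv_le u v : dotv u v <= enorm u * enorm v.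
Proof. exact: le_trans (ler_norm _) (cauchy_schwarz u v). Qed.

Lemma enormD u v : enorm (u + v) <= enorm u + enorm v.
Proof.
rewrite -(@ler_pXn2r _ 2) ?nnegrE ?addr_ge0 ?enorm_ge0 //.
rewrite sqrrD !enorm_sqr dotvDl !dotvDr (dotvC v u).
have := dotv_le u v; lra.
Qed.

Lemma enorm_triangle w u v : enorm (u - v) <= enorm (u - w) + enorm (w - v).
Proof. by rewrite -(subrKA w) enormD. Qed.

Lemma midpoint_lt x u v : u != v -> enorm (u - x) = enorm (v - x) ->
  enorm (2^-1 *: (u + v) - x) < enorm (u - x).
Proof.
move=> uv uvx; rewrite -(@ltr_pXn2r _ 2) ?nnegrE ?enorm_ge0 //.
have : 0 < enorm (u - v) ^+ 2.
  rewrite exprn_gt0 // lt_def enorm_ge0 andbT; apply/eqP => /enorm_eq0/eqP.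
  by rewrite subr_eq0 (negbTE uv).
have -> : u - v = (u - x) - (v - x) by rewrite opprB addrA subrK.
have -> : 2^-1 *: (u + v) - x = 2^-1 *: ((u - x) + (v - x)).
  rewrite addrACA -opprD scalerBr; congr (_ - _).
  by rewrite -mulr2n -[x *+ 2]scaler_nat scalerA mulVf ?scale1r ?pnatr_eq0.
move: (u - x) (v - x) uvx => {uv}u {}v /(congr1 (fun a => a ^+ 2)).
rewrite !enorm_sqr dotvBl !dotvBr dotvZl dotvZr dotvDl !dotvDr (dotvC v u).
by move=> h; lra.
Qed.

Lemma norm_coord_le u i : `|u 0 i| <= `|u|.
Proof.
rewrite [leRHS]/Num.Def.normr/= mx_normrE.
exact: (le_bigmax _ (fun ij => `|u ij.1 ij.2|) (0, i)).
Qed.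

Lemma norm_le_coord u a : 0 <= a -> (forall i, `|u 0 i| <= a) -> `|u| <= a.
Proof.
move=> a0 ua; rewrite [leLHS]/Num.Def.normr/= mx_normrE bigmax_le //.
by move=> [i j] _ /=; rewrite ord1.
Qed.

Lemma coord_le_enorm u i : `|u 0 i| <= enorm u.
Proof.
rewrite -(@ler_pXn2r _ 2) ?nnegrE ?normr_ge0 ?enorm_ge0 // enorm_sqr real_normK ?num_real //.
rewrite /dotv (bigD1 i) //= -expr2 lerDl.
by apply: sumr_ge0 => j _; rewrite -expr2 sqr_ge0.
Qed.

Lemma norm_le_enorm u : `|u| <= enorm u.
Proof. by apply: norm_le_coord (coord_le_enorm u); exact: enorm_ge0. Qed.

Lemma enorm_le_norm u : enorm u <= n%:R * `|u|.
Proof.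
rewrite -(@ler_pXn2r _ 2) ?nnegrE ?mulr_ge0 ?ler0n ?normr_ge0 ?enorm_ge0 //.
rewrite enorm_sqr exprMn.
have : dotv u u <= \sum_(i < n) `|u| ^+ 2.
  apply: ler_sum => i _; rewrite -expr2 -real_normK ?num_real //.
  by rewrite ler_pXn2r ?nnegrE ?normr_ge0 ?norm_coord_le.
move=> /le_trans; apply; rewrite sumr_const card_ord -[leLHS]mulr_natl.
rewrite ler_wpM2r ?sqr_ge0 //.
by rewrite -natrX ler_nat -mulnn; case: n => // n'; rewrite leq_pmulr.
Qed.

Lemma enorm_lipschitz_continuous (V : normedModType R) (L : R) (f : 'rV[R]_n -> V) :
  (forall x y, `|f x - f y| <= L * enorm (x - y)) -> continuous f.
Proof.
move=> fL x; apply/(@cvgrPdist_le _ _ _ (nbhs x) (nbhs_filter x)) => e e0.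
have L1 : 0 < `|L| * n%:R + 1 by rewrite ltr_wpDl // mulr_ge0 ?ler0n.
apply/(@nbhs_normP _ 'rV[R]_n x); exists (e / (`|L| * n%:R + 1)); first by rewrite /= divr_gt0.
move=> y /ltW xy /=.
apply: (le_trans (fL x y)).
rewrite -(divfK (lt0r_neq0 L1) e).
apply: le_trans (_ : (`|L| * n%:R + 1) * `|x - y| <= _); last first.
  by rewrite mulrC ler_wpM2r // ltW.
apply: le_trans (_ : `|L| * (n%:R * `|x - y|) <= _).
  apply: le_trans (_ : `|L| * enorm (x - y) <= _).
    by rewrite ler_wpM2r ?enorm_ge0 ?ler_norm.
  by rewrite ler_wpM2l ?enorm_le_norm.
by rewrite mulrA ler_wpM2r // lerDl.
Qed.

Lemma enorm_dist_le u v : `|enorm u - enorm v| <= enorm (u - v).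
Proof.
rewrite ler_norml; have := enormD (u - v) v; have := enormD (v - u) u.
rewrite !subrK (enormB v u); lra.
Qed.

Lemma continuous_enormB x : continuous (fun y => enorm (y - x)).
Proof.
apply: (@enorm_lipschitz_continuous _ 1) => u v; rewrite mul1r.
by apply: le_trans (enorm_dist_le _ _) _; rewrite opprB addrA subrK.
Qed.

Lemma open_eball x a : open [set y | enorm (y - x) < a].
Proof.
exact: (open_comp (fun y _ => @continuous_enormB x y) (@open_lt R a)).
Qed.

Lemma compact_of_enorm_bounded (A : set 'rV[R]_n) x a :
  closed A -> (forall y, A y -> enorm (y - x) <= a) -> compact A.
Proof.
move=> cA bA; apply: bounded_closed_compact => //.
exists (a + enorm x); split; first exact: num_real.
move=> M aM y /bA yx; apply: ltW; apply: le_lt_trans aM.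
apply: le_trans (norm_le_enorm y) _.
by rewrite -[y in leLHS](subrK x); apply: le_trans (enormD _ _) _; rewrite lerD2r.
Qed.

End Euclid.

Lemma enorm_mulmx_le (R : realType) (k n : nat) (C : 'M[R]_(k, n)) :
  exists2 K : R, 0 < K & forall w : 'rV[R]_k, enorm (w *m C) <= K * `|w|.
Proof.
pose B := \sum_(j < n) \sum_(i < k) `|C i j|.
have B0 : 0 <= B by do 2 apply: sumr_ge0 => ? _.
exists (n%:R * B + 1) => [|w].
  by rewrite ltr_wpDl // mulr_ge0 ?ler0n.
apply: le_trans (enorm_le_norm _) _.
apply: le_trans (_ : n%:R * (B * `|w|) <= _); last by rewrite mulrA ler_wpM2r ?lerDl.
rewrite ler_wpM2l ?ler0n //; apply: norm_le_coord => [|j]; first by rewrite mulr_ge0.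
rewrite mxE; apply: le_trans (ler_norm_sum _ _ _) _.
apply: le_trans (_ : (\sum_(i < k) `|C i j|) * `|w| <= _).
  rewrite mulr_suml; apply: ler_sum => i _.
  by rewrite normrM mulrC ler_wpM2l ?norm_coord_le.
rewrite ler_wpM2r // /B (bigD1 j) //= lerDl.
by do 2 apply: sumr_ge0 => ? _.
Qed.

Lemma exists_orthonormal_rows (R : realType) (s m : nat) (B : 'M[R]_(s, m)) d :
  (d <= \rank B)%N ->
  exists2 U : 'M[R]_(d, m), U *m U^T = 1%:M & (U <= B)%MS.
Proof.
elim: d => [_|d IHd dB]; first by exists 0; [rewrite !flatmx0|exact: sub0mx].
have [U UU UB] := IHd (ltnW dB).
pose W := (B :&: kermx U^T)%MS.
have W0 : W != 0.
  rewrite -mxrank_eq0 -lt0n.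
  have := mxrank_sum_cap B (kermx U^T); rewrite mxrank_ker -/W.
  have := rank_leq_col (B + kermx U^T)%MS.
  have := rank_leq_col U^T; have := rank_leq_row U^T; lia.
have [w0 wW] : nz_row W != 0 /\ (nz_row W <= W)%MS by rewrite nz_row_eq0 nz_row_sub.
have wB : (nz_row W <= B)%MS := submx_trans wW (capmxSl _ _).
have wU : nz_row W *m U^T = 0 by apply/sub_kermxP/(submx_trans wW)/capmxSr.
pose u := (enorm (nz_row W))^-1 *: nz_row W.
have uU : u *m U^T = 0 by rewrite -scalemxAl wU scaler0.
have uu : u *m u^T = 1%:M.
  apply/matrixP => i j; rewrite !ord1 -dotvE dotvZl dotvZr -enorm_sqr mxE /=.
  rewrite expr2 mulrA mulrACA mulrA -mulrA mulVf ?mul1r ?mulVf //;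
    by apply/eqP => /enorm_eq0/eqP; rewrite (negbTE w0).
rewrite -[d.+1]/(1 + d)%N; exists (col_mx u U); last by rewrite col_mx_sub UB scalemx_sub.
rewrite tr_col_mx mul_col_row uu UU uU.
have -> : U *m u^T = 0 by rewrite -[LHS]trmxK trmx_mul trmxK uU trmx0.
by rewrite -scalar_mx_block.
Qed.

Lemma row_free_gram_unit (R : realType) (k m : nat) (D : 'M[R]_(k, m)) :
  row_free D -> D *m D^T \in unitmx.
Proof.
move=> Dfree; rewrite -row_free_unit -kermx_eq0; apply/rowV0P => v /sub_kermxP vD.
apply: (row_free_inj Dfree); rewrite mul0mx; apply: dotvv_eq0.
by rewrite dotvE trmx_mul mulmxA -(mulmxA v) vD mul0mx mxE.
Qed.

Lemma row_free_coordinates (R : realType) (k m : nat) (D : 'M[R]_(k, m)) :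
  row_free D ->
  exists (U : 'M[R]_(m - k, m)) (C : 'M[R]_(k, m)),
    [/\ U *m U^T = 1%:M, U *m D^T = 0, C *m D^T = 1%:M & C *m U^T = 0].
Proof.
move=> Dfree; have DD := row_free_gram_unit Dfree.
have /exists_orthonormal_rows[U UU /sub_kermxP UD] : (m - k <= \rank (kermx D^T))%N.
  by rewrite mxrank_ker mxrank_tr; move: Dfree; rewrite /row_free => /eqP ->.
exists U, (invmx (D *m D^T) *m D); split => //; first by rewrite -mulmxA mulVmx.
by rewrite -mulmxA -[D *m U^T]trmxK trmx_mul trmxK UD trmx0 mulmx0.
Qed.

HB.instance Definition _ (R : realType) k :=
  Uniform_isComplete.Build 'rV[R]_k cauchy_cvg.

Lemma rV_contraction_fixpoint (R : realType) k (f : 'rV[R]_k -> 'rV[R]_k) :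
  (forall v w, `|f v - f w| <= 2^-1 * `|v - w|) -> exists v, v = f v.
Proof.
move=> fL; have fT : set_fun setT setT f by [].
have h0 : 0 <= (2^-1 : R) by rewrite invr_ge0.
have ctr : is_contraction (mkfun fT).
  exists (NngNum h0); split; first by rewrite /= invf_lt1 ?ltr1n.
  by move=> [v w] _ /=; exact: fL.
have [|v _ vf] := banach_fixed_point ctr closedT; first by exists 0.
by exists v.
Qed.

Lemma exists_rV_fixpoints (R : realType) k (T : Type) (f : T -> 'rV[R]_k -> 'rV[R]_k) :
  (forall z v w, `|f z v - f z w| <= 2^-1 * `|v - w|) ->
  exists w : T -> 'rV[R]_k, forall z v, v = f z v <-> v = w z.
Proof.
move=> fL.
have /choice[w wf] : forall z, exists v, v = f z v.
  by move=> z; exact: rV_contraction_fixpoint.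
exists w => z v; split => [vf|->]; last exact: wf.
apply/eqP; rewrite -subr_eq0 -normr_le0.
have := fL z v (w z); rewrite -vf -wf; lra.
Qed.

Definition convex_fun (R : realType) (n : nat) (f : 'rV[R]_n -> R) : Prop :=
  forall t x y, 0 <= t <= 1 ->
    f (t *: x + (1 - t) *: y) <= t * f x + (1 - t) * f y.

Lemma convex_fun_on (R : realType) (n : nat) (f : 'rV[R]_n -> R) (A : set 'rV[R]_n) :
  convex_fun f -> convex_function A f.
Proof. by move=> cf t x y _ _; apply: cf; rewrite ge0 le1. Qed.

(* The witness [g] is [\sum_j e_j] along the graph of [w]. Its convexity comes
   out of the last inequality, whose left-hand side is nonnegative. *)
Lemma controlled_implicit_function (R : realType) (d k m : nat)
    (e : 'I_k.+1 -> 'rV[R]_m -> R) (p : 'rV[R]_m) (U : 'M[R]_(d, m))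
    (C : 'M[R]_(k, m)) (b : 'rV[R]_k) (r K : R) :
  (forall i, convex_fun (e i)) ->
  (forall i x y, `|e i x - e i y| <= r * enorm (x - y)) ->
  0 < r -> 0 < K -> (forall w : 'rV[R]_k, enorm (w *m C) <= K * `|w|) ->
  k.+4%:R * (r * K) <= 2^-1 ->
  exists w : 'rV[R]_d -> 'rV[R]_k,
    [/\ forall z v,
          v = - (b + \row_i (e (lift ord0 i) (p + z *m U + v *m C) -
                             e ord0 (p + z *m U + v *m C))) <-> v = w z,
        forall y z, `|w y - w z| <= 4 * r * enorm ((y - z) *m U) &
        exists2 g : 'rV[R]_d -> R, convex_fun g &
          forall t y z, 0 <= t <= 1 ->
            `|t *: w y + (1 - t) *: w z - w (t *: y + (1 - t) *: z)| <=
            2 * (t * g y + (1 - t) * g z - g (t *: y + (1 - t) *: z))].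
Proof.
move=> ecvx elip r0 K0 CK rK.
pose E x : 'rV[R]_k := \row_i (e (lift ord0 i) x - e ord0 x).
pose X (z : 'rV[R]_d) (v : 'rV[R]_k) := p + z *m U + v *m C.
have Elip x y : `|E x - E y| <= 2 * r * enorm (x - y).
  apply: norm_le_coord => [|i]; first by rewrite !mulr_ge0 ?enorm_ge0 // ltW.
  rewrite !mxE.
  have := elip ord0 x y; have := elip (lift ord0 i) x y.
  by rewrite !ler_norml; lra.
have XB z v v' : X z v - X z v' = (v - v') *m C.
  by rewrite /X opprD addrACA subrr add0r mulmxBl.
have subE a1 a2 : - (b + a1) - - (b + a2) = a2 - a1 :> 'rV[R]_k.
  by rewrite opprK opprD addrACA addNr add0r addrC.
have k4 : 4 <= k.+4%:R :> R by rewrite ler_nat.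
have rK0 : 0 < r * K by rewrite mulr_gt0.
have rK4 : 4 * (r * K) <= 2^-1 by apply: le_trans rK; rewrite ler_wpM2r // ltW.
have [w wP] : exists w : 'rV[R]_d -> 'rV[R]_k, forall z v,
    v = - (b + E (X z v)) <-> v = w z.
  apply: exists_rV_fixpoints => z v v'.
  rewrite subE distrC; apply: le_trans (Elip _ _) _; rewrite XB.
  apply: le_trans (_ : 2 * r * (K * `|v - v'|) <= _).
    by rewrite ler_wpM2l // ?CK // mulr_ge0 // ltW.
  by rewrite mulrA ler_wpM2r //; lra.
have wE z : w z = - (b + E (X z (w z))) by exact/wP.
have wlip y z : `|w y - w z| <= 4 * r * enorm ((y - z) *m U).
  have : `|w y - w z| <= 2 * r * enorm (X y (w y) - X z (w z)).
    by rewrite {1}[w y]wE {1}[w z]wE subE distrC; exact: Elip.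
  have -> : X y (w y) - X z (w z) = (y - z) *m U + (w y - w z) *m C.
    rewrite /X !mulmxBl; move: (y *m U) (z *m U) (w y *m C) (w z *m C).
    by move=> a1 a2 a3 a4; apply/rowP => i; rewrite !mxE; ring.
  move=> h.
  have h2 : 2 * r * enorm ((y - z) *m U + (w y - w z) *m C) <=
      2 * r * (enorm ((y - z) *m U) + K * `|w y - w z|).
    rewrite ler_wpM2l ?(mulr_ge0 _ (ltW r0)) //.
    by apply: le_trans (enormD _ _) _; rewrite lerD2l.
  have h3 : 4 * (r * K) * `|w y - w z| <= 2^-1 * `|w y - w z| by rewrite ler_wpM2r.
  have := normr_ge0 (w y - w z); lra.
pose G x := \sum_j e j x.
have ctrl t y z : 0 <= t <= 1 ->
    `|t *: w y + (1 - t) *: w z - w (t *: y + (1 - t) *: z)| <=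
    2 * (t * G (X y (w y)) + (1 - t) * G (X z (w z))
         - G (X (t *: y + (1 - t) *: z) (w (t *: y + (1 - t) *: z)))).
  move=> t01; set u := t *: y + (1 - t) *: z.
  set wb := t *: w y + (1 - t) *: w z.
  have XuE : X u wb = t *: X y (w y) + (1 - t) *: X z (w z).
    rewrite /X /u /wb !mulmxDl -!scalemxAl.
    move: (y *m U) (z *m U) (w y *m C) (w z *m C) => a1 a2 a3 a4.
    by apply/rowP => i; rewrite !mxE; ring.
  pose De j := t * e j (X y (w y)) + (1 - t) * e j (X z (w z)) - e j (X u wb).
  have De0 j : 0 <= De j by rewrite /De subr_ge0 XuE; exact: ecvx.
  have DeG j : De j <= t * G (X y (w y)) + (1 - t) * G (X z (w z)) - G (X u wb).
    rewrite /G !mulr_sumr -big_split -sumrB (bigD1 j) //= lerDl.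
    by apply: sumr_ge0 => i _; exact: De0.
  have GL : `|G (X u (w u)) - G (X u wb)| <= k.+1%:R * (r * K) * `|wb - w u|.
    rewrite /G -sumrB; apply: le_trans (ler_norm_sum _ _ _) _.
    apply: le_trans (_ : \sum_(j < k.+1) (r * K * `|wb - w u|) <= _); last first.
      by rewrite sumr_const card_ord -[leLHS]mulr_natl mulrA.
    apply: ler_sum => j _; apply: le_trans (elip _ _ _) _.
    by rewrite XB -mulrA ler_wpM2l ?(ltW r0) // distrC CK.
  have EL : `|E (X u (w u)) - E (X u wb)| <= 2 * (r * K) * `|wb - w u|.
    apply: le_trans (Elip _ _) _; rewrite XB -!mulrA ler_wpM2l // ler_wpM2l ?(ltW r0) //.
    by rewrite distrC CK.
  have ED : `|E (X u wb) - (t *: E (X y (w y)) + (1 - t) *: E (X z (w z)))| <=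
      t * G (X y (w y)) + (1 - t) * G (X z (w z)) - G (X u wb).
    apply: norm_le_coord => [|i]; first exact: le_trans (De0 ord0) (DeG ord0).
    rewrite !mxE ler_norml.
    have := De0 ord0; have := DeG ord0.
    have := De0 (lift ord0 i); have := DeG (lift ord0 i); rewrite /De; lra.
  have dw : wb - w u = (E (X u (w u)) - E (X u wb)) +
      (E (X u wb) - (t *: E (X y (w y)) + (1 - t) *: E (X z (w z)))).
    rewrite subrKA /wb {1}[w y]wE {1}[w z]wE [in LHS](wE u).
    by apply/rowP => i; rewrite !mxE; ring.
  have := le_trans (ler_normD _ _) (lerD EL ED); rewrite -dw => h.
  move: GL; rewrite ler_norml => /andP[_ GL].
  have h3 : k.+4%:R * (r * K) * `|wb - w u| <= 2^-1 * `|wb - w u| by rewrite ler_wpM2r.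
  have kE : k.+4%:R = k.+1%:R + 3 :> R by rewrite -natrD addn3.
  rewrite kE in h3.
  have h4 : 0 <= (r * K) * `|wb - w u| by rewrite mulr_ge0 // ltW.
  move: (`| wb - w u |) (G _) (G _) (G _) (G _) h GL h3 h4 => a g1 g2 g3 g4.
  lra.
exists w; split=> //; exists (fun z => G (X z (w z))) => [t y z t01|]; last exact: ctrl.
rewrite -subr_ge0; have := ctrl t y z t01.
by move=> h; have := le_trans (normr_ge0 _) h; rewrite pmulr_rge0.
Qed.

Lemma orthonormal_rows_mulmxr_isometry (R : realType) (d m : nat) (U : 'M[R]_(d, m)) :
  U *m U^T = 1%:M -> forall z : 'rV[R]_d, enorm (z *m U) = enorm z.
Proof.
by move=> UU z; rewrite /enorm !dotvE trmx_mul mulmxA -(mulmxA z) UU mulmx1.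
Qed.

Lemma orthonormal_rows_mulmx_tr_le (R : realType) (d m : nat) (U : 'M[R]_(d, m)) :
  U *m U^T = 1%:M -> forall x : 'rV[R]_m, enorm (x *m U^T) <= enorm x.
Proof.
move=> UU x; have [->|x0] := eqVneq (enorm (x *m U^T)) 0; first exact: enorm_ge0.
have xp : 0 < enorm (x *m U^T) by rewrite lt_def x0 enorm_ge0.
rewrite -(ler_pM2l xp) -expr2 enorm_sqr.
rewrite -[leRHS](congr1 ( *%R^~ _) (orthonormal_rows_mulmxr_isometry UU _)).
apply: le_trans (dotv_le _ _).
by rewrite !dotvE trmx_mul trmxK mulmxA.
Qed.

Lemma affine_subspace_range (R : realType) (d m : nat) (U : 'M[R]_(d, m)) p :
  U *m U^T = 1%:M -> affine_subspace d (range (fun z : 'rV[R]_d => p + z *m U)).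
Proof.
move=> UU; exists p, (limg (linfun (mulmxr U : 'rV[R]_d -> 'rV[R]_m))); split.
  rewrite limg_dim_eq ?dimvf ?/dim /= ?mul1n //.
  apply/eqP; rewrite -subv0; apply/subvP => z; rewrite memv_cap => /andP[_].
  rewrite memv_ker lfunE /= memv0 => /eqP zU.
  by rewrite -[z]mulmx1 -UU mulmxA zU mul0mx.
apply/seteqP; split => [_ [z _ <-]|_ [v /memv_imgP[z _ ->] <-]].
  exists (z *m U) => //=; apply/memv_imgP; exists z; first exact: memvf.
  by rewrite lfunE.
by exists z => //; rewrite lfunE.
Qed.

Lemma controlled_graph_dc_submanifold (R : realType) (d k m : nat)
    (p : 'rV[R]_m) (U : 'M[R]_(d, m)) (C : 'M[R]_(k, m))
    (w : 'rV[R]_d -> 'rV[R]_k) (L c : R) (g : 'rV[R]_d -> R) (O : set 'rV[R]_m) :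
  (1 <= d <= m.-1)%N ->
  U *m U^T = 1%:M -> C *m U^T = 0 ->
  0 <= L -> (forall y z, `|w y - w z| <= L * enorm (y - z)) ->
  0 <= c -> convex_fun g ->
  (forall t y z, 0 <= t <= 1 ->
    `|t *: w y + (1 - t) *: w z - w (t *: y + (1 - t) *: z)| <=
    c * (t * g y + (1 - t) * g z - g (t *: y + (1 - t) *: z))) ->
  open O ->
  dc_submanifold d (O `&` range (fun z => p + z *m U + w z *m C)).
Proof.
move=> dm UU CU L0 wL c0 gcvx wg oO; right; split=> // x0 [Ox0 _].
pose psi z := p + z *m U + w z *m C.
pose phi (z : 'rV[R]_d) := p + z *m U.
pose coord (x : 'rV[R]_m) := (x - p) *m U^T.
have coord_phi z : coord (phi z) = z.
  by rewrite /coord /phi [p + _]addrC addrK -mulmxA UU mulmx1.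
have coord_psi z : coord (psi z) = z.
  rewrite /coord /psi -(addrA p) [p + _]addrC addrK mulmxDl -!mulmxA UU CU.
  by rewrite mulmx1 mulmx0 addr0.
have [K K0 CK] := enorm_mulmx_le C.
have psiB y z : psi y - psi z = (y - z) *m U + (w y - w z) *m C.
  rewrite /psi !mulmxBl; move: (y *m U) (z *m U) (w y *m C) (w z *m C).
  by move=> a1 a2 a3 a4; apply/rowP => i; rewrite !mxE; ring.
have psiL y z : enorm (psi y - psi z) <= (1 + K * L) * enorm (y - z).
  rewrite psiB; apply: le_trans (enormD _ _) _.
  rewrite orthonormal_rows_mulmxr_isometry // mulrDl mul1r lerD2l.
  by apply: le_trans (CK _) _; rewrite -mulrA ler_wpM2l // ltW.
have coordB x y : coord x - coord y = (x - y) *m U^T.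
  by rewrite /coord -mulmxBl opprB addrA subrK.
have coordL x y : enorm (coord x - coord y) <= enorm (x - y).
  by rewrite coordB orthonormal_rows_mulmx_tr_le.
have psi_cont : continuous psi.
  apply: (@enorm_lipschitz_continuous _ _ _ (1 + K * L)) => y z.
  exact: le_trans (norm_le_enorm _) (psiL y z).
have KL0 : 0 < 1 + K * L by rewrite ltr_pwDl // mulr_ge0 // ltW.
have opsi : open [set z | O (psi z)] := open_comp (fun z _ => psi_cont z) oO.
have coord_cont : continuous coord.
  apply: (@enorm_lipschitz_continuous _ _ _ 1) => x y.
  by rewrite mul1r; exact: le_trans (norm_le_enorm _) (coordL x y).
have phiB y z : enorm (phi y - phi z) = enorm (y - z).
  rewrite -(orthonormal_rows_mulmxr_isometry UU) mulmxBl; congr enorm.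
  by rewrite /phi opprD addrACA subrr add0r.
exists O, (range phi), (fun x => phi (coord x)), (fun x => psi (coord x)).
split=> //; first exact: affine_subspace_range.
  move=> x; split; first by exists (coord x).
  move=> _ [z _ <-]; rewrite dotvE.
  have -> : phi z - phi (coord x) = (z - coord x) *m U.
    by rewrite /phi opprD addrACA subrr add0r mulmxBl.
  have -> : x - phi (coord x) = (x - p) - (x - p) *m U^T *m U.
    by rewrite /phi opprD addrA.
  move: (z - coord x) (x - p) => a a'.
  by rewrite trmx_mul mulmxA mulmxBl -(mulmxA _ U) UU mulmx1 subrr mul0mx mxE.
have WE : (fun x => phi (coord x)) @` (O `&` range psi `&` O) =
    [set x | O (psi (coord x))] `&` range phi.
  apply/seteqP; split => [_ [x [[Ox [z _ zx]] _] <-]|x [Oz [z _ zE]]].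
    split; last by exists (coord x).
    by rewrite -zx /= coord_phi coord_psi zx.
  move: Oz; rewrite -zE /= coord_phi => Oz.
  by exists (psi z); [split=> //; split=> //; exists z|rewrite coord_psi].
split.
- exists [set x | O (psi (coord x))] => //.
  exact: (open_comp (fun x _ => coord_cont x) opsi).
- exists (1 + K * L) => // x x' [[_ [y _ yx]] _] [[_ [z _ zx]] _].
  rewrite -yx -zx -!/(psi _) !coord_psi phiB; apply/andP; split.
    by rewrite ler_pdivrMl.
  have := coordL (psi y) (psi z); rewrite !coord_psi => /le_trans; apply.
  by rewrite ler_peMl ?enorm_ge0 // lerDl mulr_ge0 // ltW.
- move=> x /set_mem[[_ [z _ <-]] _].
  by rewrite -[LHS]/(psi (coord (phi (coord (psi z))))) coord_psi coord_phi.
- exists phi; split=> // j.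
  have -> : (fun z => psi (coord (phi z)) 0 j) = (fun z => psi z 0 j).
    by apply/funext => z; rewrite coord_phi.
  split.
  + rewrite WE; suff -> : phi @^-1` ([set x | O (psi (coord x))] `&` range phi) =
      [set z | O (psi z)] by [].
    apply/seteqP; split => z /=; rewrite coord_phi; first by case.
    by move=> Oz; split=> //; exists z.
  + apply: continuous_subspaceT.
    apply: (@enorm_lipschitz_continuous _ _ _ (1 + K * L)) => y z.
    apply: le_trans (psiL y z); apply: le_trans (coord_le_enorm _ j).
    by rewrite !mxE.
  + move=> W' _ _ _ _; exists (fun z => psi z 0 j + K * c * g z), (fun z => K * c * g z).
    split; last by move=> z _; rewrite addrK.
    * apply: convex_fun_on => t y z t01.
      set u := t *: y + (1 - t) *: z.
      have -> : psi u = t *: psi y + (1 - t) *: psi z -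
          (t *: w y + (1 - t) *: w z - w u) *m C.
        rewrite /psi /u mulmxBl !mulmxDl -!scalemxAl.
        move: (y *m U) (z *m U) (w y *m C) (w z *m C) (w _ *m C).
        by move=> a1 a2 a3 a4 a5; apply/rowP => i; rewrite !mxE; ring.
      have := wg t y z t01; rewrite -/u.
      move=> /(ler_wpM2l (ltW K0)) /(le_trans (CK _)) /(le_trans (coord_le_enorm _ j)).
      rewrite ler_norml => /andP[+ _].
      move: (_ *m C) (psi y) (psi z) => a a1 a2; rewrite !mxE; lra.
    * apply: convex_fun_on => t y z t01.
      have := gcvx t y z t01; rewrite -subr_ge0 => h.
      rewrite -subr_ge0.
      have := mulr_ge0 (mulr_ge0 (ltW K0) c0) h; lra.
Qed.

Lemma differentiable_diff_le (R : realType) (m : nat) (f : 'rV[R]_m -> R)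
    (x v : 'rV[R]_m) (c : R) :
  differentiable f x ->
  (forall s, 0 < s <= 1 -> f (s *: v + x) - f x <= s * c) -> 'd f x v <= c.
Proof.
move=> df fc; rewrite -deriveE // leNgt; apply/negP => cD.
have e0 : 0 < 'D_v f x - c by rewrite subr_gt0.
have /cvgrPdist_lt/(_ _ e0)[/= h h0 hD] := @diff_derivable _ _ _ f x v df.
pose s := Num.min (h / 2) 1.
have s0 : 0 < s by rewrite lt_min divr_gt0 //=.
have sh : s < h.
  by apply: le_lt_trans (_ : h / 2 < h); [rewrite ge_min lexx|lra].
have := hD s; rewrite /= sub0r normrN gtr0_norm // => /(_ sh (lt0r_neq0 s0)).
have := fc s; rewrite s0 ge_min lexx orbT => /(_ isT) fs.
have : s^-1 *: (f (s *: v + x) - f x) <= c by rewrite ler_pdivrMl.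
rewrite /derive => h1 /(le_lt_trans (ler_norm _)).
move: h1; rewrite /=; lra.
Qed.

Section Distance.
Context {R : realType} {m : nat} (N : set 'rV[R]_m).
Hypothesis N0 : N !=set0.
Implicit Types (x y a : 'rV[R]_m).

Lemma dist_to_le x a : N a -> dist_to N x <= enorm (a - x).
Proof.
move=> Na; apply: ge_inf; last by exists a.
by exists 0 => _ [b _ <-]; exact: enorm_ge0.
Qed.

Lemma le_dist_to x r : (forall a, N a -> r <= enorm (a - x)) -> r <= dist_to N x.
Proof.
move=> Nr; apply: lb_le_inf; first by case: N0 => a Na; exists (enorm (a - x)); exists a.
by move=> _ [a Na <-]; exact: Nr.
Qed.

Lemma dist_to_ge0 x : 0 <= dist_to N x.
Proof. by apply: le_dist_to => a _; exact: enorm_ge0. Qed.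

Lemma dist_to_lipschitz x y : dist_to N x <= dist_to N y + enorm (x - y).
Proof.
rewrite -lerBlDr; apply: le_dist_to => a Na; rewrite lerBlDr.
apply: le_trans (dist_to_le x Na) _.
by rewrite (enormB x); exact: enorm_triangle.
Qed.

Lemma nearestP x a : N a -> (forall b, N b -> enorm (a - x) <= enorm (b - x)) ->
  nearest N x a.
Proof.
by move=> Na aN; split=> //; apply/eqP; rewrite eq_le dist_to_le // le_dist_to.
Qed.

Lemma nearest_exists x : closed N -> exists a, nearest N x a.
Proof.
move=> cN; have [b Nb] := N0.
pose A := N `&` [set a | enorm (a - x) <= enorm (b - x)].
have cA : compact A.
  apply: (@compact_of_enorm_bounded _ _ _ x (enorm (b - x))); last by move=> a [].
  apply: closedI => //.
  exact: (closed_comp (fun y _ => @continuous_enormB _ _ x y) (@closed_le R _)).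
have A0 : A !=set0 by exists b; split=> //=.
have cf : {within A, continuous (fun a => enorm (a - x))}.
  exact/continuous_subspaceT/continuous_enormB.
have [a /set_mem[Na ab] amin] := compact_EVT_min A0 cA cf.
exists a; apply: nearestP => // c Nc.
have [cb|bc] := leP (enorm (c - x)) (enorm (b - x)); last exact: le_trans ab (ltW bc).
by apply: amin; apply/mem_set; split.
Qed.

Lemma two_nearest_Sigma x a b :
  ~ N x -> a != b -> nearest N x a -> nearest N x b -> Sigma N x.
Proof.
move=> Nx ab [Na xa] [Nb xb]; split=> // df.
have toward c : N c -> dist_to N x = enorm (c - x) ->
    'd (dist_to N) x (c - x) <= - dist_to N x.
  move=> Nc xc; apply: differentiable_diff_le => // s /andP[s0 s1].
  have := dist_to_le (s *: (c - x) + x) Nc.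
  have -> : c - (s *: (c - x) + x) = (1 - s) *: (c - x).
    by apply/rowP => i; rewrite !mxE; ring.
  by rewrite enormZ ger0_norm ?subr_ge0 // -xc; lra.
have := toward a Na xa; have := toward b Nb xb.
have ab_lt : enorm (2^-1 *: (a + b) - x) < dist_to N x.
  by rewrite xa midpoint_lt // -xa -xb.
pose v := 2^-1 *: (a + b) - x.
have vE : v = 2^-1 *: ((a - x) + (b - x)).
  by apply/rowP => i; rewrite !mxE; lra.
have : 'd (dist_to N) x (- v) <= enorm v.
  apply: differentiable_diff_le => // s /andP[s0 s1].
  have := dist_to_lipschitz (s *: (- v) + x) x.
  by rewrite addrK enormZ enormN gtr0_norm // -lerBlDl.
rewrite linearN vE linearZ linearD -vE /=; move: ab_lt; rewrite -/v.
rewrite /GRing.scale /=; lra.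
Qed.

(* [|x|^2 - dist^2] is the supremum over [a] in N of [2 <x, a> - |a|^2]. *)
Definition asplund q x : R :=
  (enorm x ^+ 2 - dist_to N x ^+ 2) / 2 - dotv x q.

Lemma asplund_ge q x a : N a -> dotv x (a - q) - enorm a ^+ 2 / 2 <= asplund q x.
Proof.
move=> Na; have := dist_to_le x Na.
rewrite -(@ler_pXn2r _ 2) ?nnegrE ?enorm_ge0 ?dist_to_ge0 //.
rewrite enorm_sqrB /asplund dotvBr (dotvC a x); lra.
Qed.

Lemma asplund_nearest q x a : nearest N x a ->
  asplund q x = dotv x (a - q) - enorm a ^+ 2 / 2.
Proof.
by move=> [_ xa]; rewrite /asplund xa enorm_sqrB dotvBr (dotvC a x); lra.
Qed.

Lemma asplund_convex q : closed N -> convex_fun (asplund q).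
Proof.
move=> cN t x y /andP[t0 t1].
have [a az] := nearest_exists (t *: x + (1 - t) *: y) cN.
rewrite (asplund_nearest q az) dotvDl !dotvZl; have Na : N a by case: az.
have t1' : 0 <= 1 - t by rewrite subr_ge0.
have := ler_wpM2l t0 (asplund_ge q x Na).
have := ler_wpM2l t1' (asplund_ge q y Na); lra.
Qed.

Lemma asplund_lipschitz q r x y : closed N -> (forall a, N a -> enorm (a - q) <= r) ->
  `|asplund q x - asplund q y| <= r * enorm (x - y).
Proof.
move=> cN Nr.
have le u v : asplund q u - asplund q v <= r * enorm (u - v).
  have [a au] := nearest_exists u cN; have Na : N a by case: au.
  rewrite (asplund_nearest q au).
  have := asplund_ge q v Na.
  have := dotv_le (u - v) (a - q); rewrite dotvBl.
  have := ler_wpM2l (enorm_ge0 (u - v)) (Nr a Na); lra.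
by rewrite ler_norml; have := le x y; have := le y x; rewrite (enormB y x); lra.
Qed.

Lemma nearest_localized (J : Type) (q : J -> 'rV[R]_m) p r :
  closed N -> 0 < r -> nearest N p `<=` range q ->
  exists2 d, 0 < d & forall x a, enorm (x - p) < d -> nearest N x a ->
    exists i, enorm (a - q i) <= r.
Proof.
move=> cN r0 Nq; set rho := dist_to N p.
pose A := N `&` [set a | enorm (a - p) <= rho + 1] `&`
  \bigcap_(i in @setT J) [set a | r <= enorm (a - q i)].
have cA : compact A.
  apply: (@compact_of_enorm_bounded _ _ _ p (rho + 1)); last by move=> a [[]].
  apply: closedI; first apply: closedI => //.
    exact: (closed_comp (fun y _ => @continuous_enormB _ _ p y) (@closed_le R _)).
  apply: closed_bigI => i _.
  exact: (closed_comp (fun y _ => @continuous_enormB _ _ (q i) y) (@closed_ge R _)).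
have [eta eta0 Aeta] : exists2 eta, 0 < eta & forall a, A a -> rho + eta <= enorm (a - p).
  have [[a0 Aa0]|A0] := pselect (A !=set0); last first.
    by exists 1 => // a Aa; case: A0; exists a.
  have cf : {within A, continuous (fun a => enorm (a - p))}.
    exact/continuous_subspaceT/continuous_enormB.
  have [a /set_mem[[Na _] aq] amin] := compact_EVT_min (ex_intro _ a0 Aa0) cA cf.
  exists (enorm (a - p) - rho) => [|b Ab]; last first.
    by rewrite addrC subrK; apply: amin; exact/mem_set.
  rewrite subr_gt0 lt_neqAle dist_to_le // andbT; apply/eqP => ap.
  have [i _ qi] := Nq a (conj Na ap).
  by have := aq i I; rewrite /= qi subrr enorm0 leNgt r0.
exists (Num.min eta 1 / 2) => [|x a xp xa]; first by rewrite divr_gt0 // lt_min eta0 /=.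
have Na : N a by case: xa.
have ap : enorm (a - p) < rho + Num.min eta 1.
  apply: le_lt_trans (enorm_triangle x a p) _.
  have [_ <-] := xa; have := dist_to_lipschitz x p; rewrite -/rho; lra.
apply: contrapT => noi.
have : A a.
  split; first by split=> //=; apply: ltW (lt_le_trans ap _); rewrite lerD2l ge_min lexx orbT.
  by move=> i _ /=; rewrite leNgt; apply/negP => ai; apply: noi; exists i; exact: ltW.
move=> /Aeta; rewrite leNgt => /negP; apply; apply: lt_le_trans ap _.
by rewrite lerD2l ge_min lexx.
Qed.

End Distance.

Lemma affine_subspace_convex (R : realType) (n d : nat) (P : set 'rV[R]_n) :
  affine_subspace d P -> convex_set P.
Proof.
move=> [a [V [_ ->]]] x y t /set_mem[u uV <-] /set_mem[v vV <-]; apply/mem_set.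
exists (t%:num *: u + (1 - t%:num) *: v); first by rewrite /= rpredD // rpredZ.
suff : a + (t%:num *: u + (1 - t%:num) *: v) =
  t%:num *: (a + u) + (1 - t%:num) *: (a + v) by [].
by apply/rowP => i; rewrite !mxE; ring.
Qed.

Lemma convex_hull_sub_affine (R : realType) (n d : nat) (A P : set 'rV[R]_n) :
  affine_subspace d P -> A `<=` P -> affine_hull (convex_hull A) `<=` P.
Proof.
move=> aP AP; apply: smallest_sub; first by exists d.
by apply: smallest_sub => //; exact: affine_subspace_convex aP.
Qed.

Lemma affinely_independent_row_free (R : realType) (k m : nat)
    (q : 'I_k.+1 -> 'rV[R]_m) :
  has_affine_dim (convex_hull (range q)) k ->
  row_free (\matrix_i (q (lift ord0 i) - q ord0)).
Proof.
move=> [a [V [dV hV]]].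
pose X := [tuple q (lift ord0 i) - q ord0 | i < k].
have XV i : q (lift ord0 i) - q ord0 \in <<X>>%VS.
  by apply: memv_span; apply/mapP; exists i; rewrite // mem_enum.
have qX : affine_hull (convex_hull (range q)) `<=`
    [set q ord0 + v | v in [set` <<X>>%VS]].
  apply: (@convex_hull_sub_affine _ _ (\dim <<X>>%VS)).
    by exists (q ord0), <<X>>%VS.
  move=> _ [j _ <-]; case: (unliftP ord0 j) => [i|] ->.
    by exists (q (lift ord0 i) - q ord0) => //=; rewrite addrC subrK.
  by exists 0; rewrite ?addr0 //= mem0v.
have VX : (V <= <<X>>)%VS.
  apply/subvP => v vV.
  have [|u uX qu] := qX (a + 0); first by rewrite hV; exists 0; rewrite //= mem0v.
  have [|u' uX' qu'] := qX (a + v); first by rewrite hV; exists v.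
  have -> : v = u' - u.
    apply: (addrI a); rewrite -qu' addrA -[a in RHS]addr0 -qu.
    by apply/rowP => i; rewrite !mxE; ring.
  by rewrite rpredB.
have Xfree : free X.
  by rewrite /free eqn_leq dim_span size_tuple; move: (dimvS VX); rewrite dV.
rewrite -kermx_eq0; apply/rowV0P => v /sub_kermxP vD; apply/rowP => i; rewrite mxE.
apply: (freeP Xfree (fun i => v 0 i)); rewrite -[RHS]vD mulmx_sum_row.
by apply: eq_bigr => j _; rewrite rowK -tnth_nth tnth_mktuple.
Qed.

Lemma card_eq_ord_enum (T : pointedType) (A : set T) (n : nat) :
  (A #= `I_n)%card -> exists2 f : 'I_n -> T, injective f & A = range f.
Proof.
rewrite card_eq_sym => /card_set_bijP[f [fA finj fsurj]].
exists (fun i => f (val i)) => [i j ij|].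
  by apply/val_inj/finj => //; apply/mem_set => /=.
apply/seteqP; split => [a /fsurj[i /= ik <-]|_ [i _ <-]]; last by apply: fA => /=.
by exists (Ordinal ik).
Qed.

Lemma card_eq_injection_leq (T : Type) (A : set T) (n j : nat) (f : 'I_n -> T) :
  injective f -> (forall i, A (f i)) -> (A #= `I_j)%card -> (n <= j)%N.
Proof.
case: n f => // n f finj fA; rewrite card_eq_le => /andP[Aj _].
rewrite -card_le_II; apply: card_le_trans Aj.
have fI : {in `I_n.+1 &, injective (fun i => f (inord i))}.
  move=> i i' /set_mem/= iI /set_mem/= iI' /finj/(congr1 val).
  by rewrite /= !inordK.
have := inj_card_eq fI; rewrite card_eq_le => /andP[_ /card_le_trans]; apply.
by apply: subset_card_le => _ [i _ <-].
Qed.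

Lemma exists_separating_radius (R : realType) (n s : nat) (q : 'I_s -> 'rV[R]_n) (c : R) :
  injective q -> 0 < c ->
  exists r, [/\ 0 < r, r <= c & forall i j, i != j -> 2 * r < enorm (q i - q j)].
Proof.
move=> qinj c0.
pose F (ij : 'I_s * 'I_s) := if ij.1 == ij.2 then c else enorm (q ij.1 - q ij.2) / 3.
have F0 ij : 0 < F ij.
  rewrite /F; case: eqP => // /eqP ij0; rewrite divr_gt0 // lt_def enorm_ge0 andbT.
  by apply: contra_neq ij0 => /enorm_eq0/eqP; rewrite subr_eq0 => /eqP/qinj.
exists (\big[Num.min/c]_ij F ij); split.
- exact: lt_bigmin.
- exact: bigmin_le_id.
- move=> i j ij; have := bigmin_le c (i, j) F; have := F0 (i, j).
  by rewrite /F /= (negbTE ij); lra.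
Qed.

Theorem theorem2p11 (R : realType) (m : nat) (hm : (2 <= m)%N)
    (N : set 'rV[R]_m) (hN0 : N !=set0) (hNclosed : closed N)
    (k : nat) (hk : (1 <= k <= m)%N)
    (p : 'rV[R]_m) (hp : Sigma_card k.+1 N p)
    (hdim : has_affine_dim (convex_hull (nearest N p)) k) :
  exists S : set 'rV[R]_m,
    [/\ dc_submanifold (m - k) S,
        S p &
        S `<=` Sigma N `\`
               \bigcup_(j in [set j | (2 <= j <= k)%N]) Sigma_card j N].
Proof.
have [cardp Sp] : (nearest N p #= `I_k.+1)%card /\ Sigma N p by case: hp.
have [mk|km] := eqVneq m k.
  exists [set p]; split=> //; first by left; split; [rewrite mk subnn|exists p].
  move=> _ ->; split=> // -[j /= /andP[_ jk] [_ cardj]].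
  have : (`I_j #= `I_k.+1)%card by apply: card_eq_trans cardp; rewrite card_eq_sym.
  by move=> /card_eq_II jk1; move: jk; rewrite jk1 ltnn.
have [q qinj qE] := card_eq_ord_enum cardp.
have qnear i : nearest N p (q i) by rewrite qE; exists i.
rewrite qE in hdim.
pose D := \matrix_i (q (lift ord0 i) - q ord0).
have [U [C [UU UD CD CU]]] := row_free_coordinates (affinely_independent_row_free hdim).
have [K K0 CK] := enorm_mulmx_le C.
have k4 : 0 < k.+4%:R :> R by rewrite ltr0n.
have c0 : 0 < 2^-1 / (k.+4%:R * K) by rewrite divr_gt0 ?mulr_gt0 ?invr_gt0.
have [r [r0 rc rq]] := exists_separating_radius qinj c0.
have rK : k.+4%:R * (r * K) <= 2^-1.
  by move: rc; rewrite ler_pdivlMr ?mulr_gt0 // mulrCA.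
pose Ni i := N `&` [set a | enorm (a - q i) <= r].
have Niq i : Ni i (q i).
  by case: (qnear i) => Nq _; split=> //=; rewrite subrr enorm0 ltW.
have Ni0 i : Ni i !=set0 by exists (q i).
have cNi i : closed (Ni i).
  apply: closedI => //.
  exact: (closed_comp (fun y _ => @continuous_enormB _ _ (q i) y) (@closed_le R _)).
have [d d0 near_d] : exists2 d, 0 < d & forall x a, enorm (x - p) < d ->
    nearest N x a -> exists i, enorm (a - q i) <= r.
  by apply: nearest_localized => //; rewrite qE.
pose e i := asplund (Ni i) (q i).
have ecvx i : convex_fun (e i) by exact: asplund_convex.
have elip i x y : `|e i x - e i y| <= r * enorm (x - y).
  by apply: asplund_lipschitz => // a [].
pose b := p *m D^T.
have [w [wP wlip [g gcvx wg]]] :=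
  controlled_implicit_function p U b ecvx elip r0 K0 CK rK.
pose psi z := p + z *m U + w z *m C.
have DE x i : (x *m D^T) 0 i = dotv x (q (lift ord0 i)) - dotv x (q ord0).
  rewrite -dotvBr [LHS]mxE; apply: eq_bigr => j _.
  by rewrite [in X in _ * X = _]mxE [in X in _ * X = _]mxE.
have eE x i : e (lift ord0 i) x - e ord0 x + (x *m D^T) 0 i =
    (dist_to (Ni ord0) x ^+ 2 - dist_to (Ni (lift ord0 i)) x ^+ 2) / 2.
  rewrite DE /e /asplund; move: (dist_to _ _) (dist_to _ _) (enorm x) => a1 a2 a3.
  by move: (dotv _ _) (dotv _ _) => a4 a5; lra.
have equidist z j : dist_to (Ni j) (psi z) = dist_to (Ni ord0) (psi z).
  case: (unliftP ord0 j) => [i ->|-> //].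
  have /rowP/(_ i) := (wP z (w z)).2 erefl; rewrite -/(psi z) !mxE => wz.
  have psiD : (psi z *m D^T) 0 i = b 0 i + w z 0 i.
    by rewrite /psi !mulmxDl -!mulmxA UD CD mulmx0 mulmx1 addr0 mxE.
  have := eE (psi z) i; rewrite psiD wz [b 0 i]mxE.
  rewrite [X in X = _ -> _](_ : _ = 0); last first.
    by move: (e _ _) (e _ _) (\sum_(_ | _) _) => a1 a2 a3; ring.
  have := dist_to_ge0 (Ni0 ord0) (psi z); have := dist_to_ge0 (Ni0 (lift ord0 i)) (psi z).
  move: (dist_to _ _) (dist_to _ _) => a1 a2 a10 a20 h.
  by apply/eqP; rewrite -(@eqrXn2 _ 2) //; apply/eqP; lra.
have distp i : dist_to (Ni i) p = dist_to N p.
  apply/eqP; rewrite eq_le; have [_ pq] := qnear i.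
  rewrite {1}pq dist_to_le //=; apply: le_dist_to => // a [Na _].
  exact: dist_to_le.
have w0 : w 0 = 0.
  apply/esym/(wP 0 0); apply/esym/eqP; rewrite oppr_eq0; apply/eqP.
  rewrite mul0mx mul0mx !addr0; apply/rowP => i.
  have := eE p i; rewrite !distp subrr mul0r -/b !mxE; lra.
have psi0 : psi 0 = p by rewrite /psi w0 !mul0mx !addr0.
have Np : ~ N p by case: Sp.
have rho0 : 0 < dist_to N p.
  rewrite lt_def dist_to_ge0 // andbT; apply/eqP => p0; apply: Np.
  case: (qnear ord0) => Nq; rewrite p0 => /esym/enorm_eq0/eqP.
  by rewrite subr_eq0 => /eqP <-.
pose O : set 'rV[R]_m := [set x | enorm (x - p) < Num.min d (dist_to N p)].
exists (O `&` range psi); split.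
- apply: (@controlled_graph_dc_submanifold _ _ _ _ p U C w (4 * r) 2 g) => //.
  + case/andP: hk => k1 kle; rewrite subn_gt0 ltn_neqAle eq_sym km kle /=.
    by rewrite -subn1 leq_sub2l.
  + by rewrite mulr_ge0 // ltW.
  + by move=> y z; rewrite -(orthonormal_rows_mulmxr_isometry UU); exact: wlip.
  + exact: open_eball.
- split; last by exists 0.
  by rewrite /O /= subrr enorm0 lt_min d0.
move=> x [Ox [z _ zx]].
have [xd xrho] : enorm (x - p) < d /\ enorm (x - p) < dist_to N p.
  by move: Ox; rewrite /O /= lt_min => /andP[].
have Nx : ~ N x by move=> /(dist_to_le p); rewrite leNgt xrho.
have eqd j : dist_to (Ni j) x = dist_to N x.
  have [a xa] := nearest_exists hN0 x hNclosed; have [i ai] := near_d x a xd xa.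
  have -> : dist_to (Ni j) x = dist_to (Ni i) x by rewrite -zx !equidist.
  apply/eqP; rewrite eq_le; apply/andP; split.
    by case: xa => Na ->; apply: dist_to_le.
  by apply: le_dist_to => // c [Nc _]; exact: dist_to_le.
have /choice[s sP] : forall i, exists a, nearest (Ni i) x a.
  by move=> i; exact: nearest_exists.
have snear i : nearest N x (s i).
  by have [[Ns _] xs] := sP i; split=> //; rewrite -xs eqd.
have sinj : injective s.
  move=> i j sij; apply: contrapT => /eqP ij.
  have [[_ si] _] := sP i; have [[_ sj] _] := sP j.
  have := rq i j ij; have := enorm_triangle (s i) (q i) (q j).
  by rewrite {2}sij (enormB (q i) (s i)); move: si sj => /=; lra.
split; last first.
  move=> [j /= /andP[_ jk] [_ cardj]].
  by have := card_eq_injection_leq sinj snear cardj; rewrite ltnNge jk.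
case/andP: hk => k1 _.
apply: (@two_nearest_Sigma _ _ N hN0 x (s ord0) (s ord_max)) => //.
by apply/eqP => /sinj/(congr1 val) /= k0; rewrite -k0 in k1.
Qed.
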